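(* Let $m\in\mathbb N$, let $\widetilde G_m=[1,m]\times\mathbb Z$ be the bilateral lattice graph with vertex set $\widetilde V_m$, let $\mu=(\mu_{i,j})$ be a nonzero weight, i.e. $\mu:\widetilde V_m\to\mathbb C\setminus\{0\}$, and let $X=\ell^p(\widetilde V_m,\mu)$, $1\le p<\infty$, or $X=c_0(\widetilde V_m,\mu)$. Suppose that the backward shift $B$ of $\widetilde G_m$ is bounded on $X$, and let $\mathcal F$ be a Furstenberg family on $\mathbb N_0$. Then the following assertions are equivalent: (i) $B$ is $\widetilde{\mathcal F}$-transitive; (ii) $B$ is $\mathcal F$-transitive; (iii) for every nonempty finite set $E\subseteq\widetilde V_m$ and every $\varepsilon>0$, $$\mathcal A(E,\varepsilon)=\bigcap_{v_{i,j}\in E}\left\{n\in\mathbb N: n^{m-i}\bigl(|\mu_{i,j+n}|+|\mu_{i,j-n}|\bigr)<\varepsilon\right\}\in\mathcal F.$$ If, in addition, $A\in\mathcal F$ implies $A\cap[N,\infty)\in\mathcal F$ for every $N\in\mathbb N$, then the preceding assertions are also equivalent to (iv) $B$ is topologically $\mathcal F$-recurrent.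
   Context: $\mathbb N=\{1,2,\dots\}$, $\mathbb N_0=\{0,1,2,\dots\}$. Lattice graph: $\widetilde G_m$ is the directed graph with vertex set $\widetilde V_m=\{v_{i,j}:1\le i\le m,\ j\in\mathbb Z\}$ and edges $v_{i,j}\to v_{i,j+1}$ ($1\le i\le m$, $j\in\mathbb Z$) and $v_{i,j}\to v_{i+1,j}$ ($1\le i<m$, $j\in\mathbb Z$). For a vertex $v$, $\operatorname{Chi}(v)=\{u:(v,u)\text{ is an edge}\}$. The backward shift is $(Bf)(v)=\sum_{u\in\operatorname{Chi}(v)}f(u)$ for functions $f:\widetilde V_m\to\mathbb C$. Weighted spaces: put $\mu_{i,j}=\mu(v_{i,j})$. $\ell^p(\widetilde V_m,\mu)$ is the space of $f:\widetilde V_m\to\mathbb C$ with $\|f\|=\left(\sum_{v_{i,j}}|\mu_{i,j}f(v_{i,j})|^p\right)^{1/p}<\infty$; $c_0(\widetilde V_m,\mu)$ is the space of $f:\widetilde V_m\to\mathbb C$ such that $\{v_{i,j}:|\mu_{i,j}f(v_{i,j})|\ge\delta\}$ is finite for every $\delta>0$, with norm $\sup_{v_{i,j}}|\mu_{i,j}f(v_{i,j})|$. Furstenberg families: a nonempty collection $\mathcal F$ of subsets of $\mathbb N_0$ is a Furstenberg family if every member of $\mathcal F$ is infinite and $A\in\mathcal F$, $A\subseteq C\subseteq\mathbb N_0$ imply $C\in\mathcal F$. The enlarged family $\widetilde{\mathcal F}$ consists of all $A\subseteq\mathbb N_0$ such that for every $N\in\mathbb N_0$ there is $D\in\mathcal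 F$ with $(D+\{-N,-N+1,\dots,N\})\cap\mathbb N_0\subseteq A$; it is again a Furstenberg family. For a bounded linear operator $T$ on $X$ and nonempty open $U,V\subseteq X$, $N_T(U,V)=\{n\in\mathbb N_0:T^n(U)\cap V\ne\varnothing\}$. $T$ is $\mathcal F$-transitive if $N_T(U,V)\in\mathcal F$ for all nonempty open $U,V\subseteq X$ (and similarly for $\widetilde{\mathcal F}$); $T$ is topologically $\mathcal F$-recurrent if $N_T(U,U)\in\mathcal F$ for every nonempty open $U\subseteq X$. *)

(* Defs.v *)
From HB Require Import structures.
From mathcomp Require Import all_boot all_order all_algebra.
From mathcomp Require Import all_classical all_reals all_analysis.
From mathcomp Require Import complex ring.

Set Implicit Arguments.
Unset Strict Implicit.
Unset Printing Implicit Defensive.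

Import Order.TTheory GRing.Theory Num.Theory.
Import numFieldNormedType.Exports.
Import ComplexField.Normc.

Local Open Scope classical_set_scope.
Local Open Scope ring_scope.
Local Open Scope complex_scope.

(* The row index i of v_{i,j} ranges over 1..m in the mathematical text and over
   0..m-1 in 'I_m: v_{i,j} is the pair (i-1, j). *)
Definition lattice (m : nat) : Type := ('I_m * int)%type.
HB.instance Definition _ m := Countable.on (lattice m).

Definition edge m (v u : lattice m) : Prop :=
  (u.1 = v.1 /\ u.2 = v.2 + 1) \/ (u.1 = v.1.+1 :> nat /\ u.2 = v.2).

Definition Chi m (v : lattice m) : set (lattice m) := [set u | edge v u].

(* The finitely supported sum below is a genuine sum over Chi v. *)
Lemma finite_Chi m (v : lattice m) : finite_set (Chi v).
Proof.
apply: (@sub_finite_set _ _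
  ([set (v.1, v.2 + 1)] `|` [set (i, v.2) | i in [set: 'I_m]])).
  move=> [i j] /= [[/= -> ->]|[/= _ ->]]; first by left.
  by right; exists i.
rewrite finite_setU; split; first exact: finite_set1.
exact/finite_image/finite_finset.
Qed.

Definition backward_shift (R : realType) m (f : lattice m -> R[i]) :
    lattice m -> R[i] :=
  fun v => \sum_(u \in Chi v) f u.

Record weight (R : realType) (I : choiceType) := Weight {
  weight_fun :> I -> R[i];
  weight_neq0 : forall v, weight_fun v != 0 }.

Inductive space_kind (R : realType) :=
| ell_p (p : R) of 1 <= p
| c_zero.

Section moduli.
Context {R : realType} {I : choiceType}.
Implicit Types (K : space_kind R) (a b h : I -> R).

(* Membership and norm in terms of the family a of moduli |mu v * f v|. *)
Definition kind_mem K a : Prop :=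
  match K with
  | ell_p p _ => (\esum_(v in [set: I]) (a v `^ p)%:E < +oo)%E
  | c_zero => forall d : R, 0 < d -> finite_set [set v | d <= a v]
  end.

Definition kind_norm K a : R :=
  match K with
  | ell_p p _ => fine (\esum_(v in [set: I]) (a v `^ p)%:E)%E `^ p^-1
  | c_zero => sup (range a)
  end.

Let esum_leP a (x : \bar R) :
  (forall A : set I, finite_set A -> (\sum_(v \in A) (a v)%:E <= x)%E) ->
  (\esum_(v in [set: I]) (a v)%:E <= x)%E.
Proof.
by move=> H; apply: ge_ereal_sup => _ /= [A [fA _] <-]; exact: H.
Qed.

Let esum_ub a (A : set I) : finite_set A ->
  (\sum_(v \in A) (a v)%:E <= \esum_(v in [set: I]) (a v)%:E)%E.
Proof. by move=> fA; apply: ereal_sup_ubound; exists A. Qed.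

Let ell_le p a (c : R) : 1 <= p -> 0 <= c ->
  (\esum_(v in [set: I]) (a v `^ p)%:E <= (c `^ p)%:E)%E ->
  (\esum_(v in [set: I]) (a v `^ p)%:E < +oo)%E /\
  fine (\esum_(v in [set: I]) (a v `^ p)%:E)%E `^ p^-1 <= c.
Proof.
move=> p1 c0 H; have p0 : 0 < p by rewrite (lt_le_trans _ p1).
have Hoo := le_lt_trans H (ltry _); split => //.
have S0 : (0 <= \esum_(v in [set: I]) (a v `^ p)%:E)%E.
  by apply: esum_ge0 => v _; rewrite lee_fin powR_ge0.
rewrite -[leRHS](powRr1 c0) -(mulfV (lt0r_neq0 p0)) powRrM.
rewrite ge0_ler_powR ?invr_ge0 ?(ltW p0)// ?nnegrE ?fine_ge0 ?powR_ge0//.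
by rewrite -lee_fin fineK// ge0_fin_numE.
Qed.

Let ell_norm p a : 1 <= p ->
  (\esum_(v in [set: I]) (a v `^ p)%:E < +oo)%E ->
  (\esum_(v in [set: I]) (a v `^ p)%:E)%E =
  ((fine (\esum_(v in [set: I]) (a v `^ p)%:E)%E `^ p^-1) `^ p)%:E.
Proof.
move=> p1 H; have p0 : 0 < p by rewrite (lt_le_trans _ p1).
have S0 : (0 <= \esum_(v in [set: I]) (a v `^ p)%:E)%E.
  by apply: esum_ge0 => v _; rewrite lee_fin powR_ge0.
rewrite -powRrM mulVf ?gt_eqF// powRr1 ?fine_ge0//.
by rewrite fineK// ge0_fin_numE.
Qed.

Let ell_conv p a b h (s t : R) : 1 <= p -> 0 < s -> 0 < t ->
  (forall v, 0 <= a v) -> (forall v, 0 <= b v) ->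
  (forall v, 0 <= h v <= a v + b v) ->
  (\esum_(v in [set: I]) (a v `^ p)%:E <= (s `^ p)%:E)%E ->
  (\esum_(v in [set: I]) (b v `^ p)%:E <= (t `^ p)%:E)%E ->
  (\esum_(v in [set: I]) (h v `^ p)%:E <= ((s + t) `^ p)%:E)%E.
Proof.
move=> p1 s0 t0 a0 b0 hab Ha Hb.
have p0 : 0 < p by rewrite (lt_le_trans _ p1).
have st0 : 0 < s + t by rewrite addr_gt0.
pose l := s / (s + t).
have l0 : 0 <= l by rewrite divr_ge0// ltW.
have l1 : l <= 1 by rewrite ler_pdivrMr// mul1r lerDl ltW.
have l1E : 1 - l = t / (s + t).
  by rewrite -[1](mulfV (lt0r_neq0 st0)) -mulrBl addrAC subrr add0r.
have pt v : h v `^ p <= (s + t) `^ p * (l * (s `^ p)^-1) * a v `^ p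
                      + (s + t) `^ p * ((1 - l) * (t `^ p)^-1) * b v `^ p.
  have /andP[h0 hle] := hab v.
  apply: (@le_trans _ _ ((a v + b v) `^ p)).
    by rewrite ge0_ler_powR ?(ltW p0) ?nnegrE ?addr_ge0.
  have -> : a v + b v = (s + t) * (l * (a v / s) + (1 - l) * (b v / t)).
    by rewrite l1E /l; field; rewrite !gt_eqF.
  have as0 : 0 <= a v / s by rewrite divr_ge0// ltW.
  have bt0 : 0 <= b v / t by rewrite divr_ge0// ltW.
  have l10 : 0 <= 1 - l by rewrite subr_ge0.
  rewrite powRM; [|exact: ltW|by apply: addr_ge0; exact: mulr_ge0].
  rewrite [leRHS](_ : _ = (s + t) `^ p *
      (l * (a v `^ p / s `^ p) + (1 - l) * (b v `^ p / t `^ p))); last by ring.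
  rewrite ler_wpM2l ?powR_ge0//.
  have cv := @convex_powR R p p1 (Itv01 l0 l1) (a v / s) (b v / t).
  have dv (x y : R) : 0 <= x -> 0 < y -> (x / y) `^ p = x `^ p / y `^ p.
    move=> x0 y0; rewrite powRM ?invr_ge0 ?(ltW y0)//; congr (_ * _).
    by rewrite -powR_inv1 ?(ltW y0)// -powRrM mulN1r powRN.
  move: cv; rewrite !inE/= !in_itv/= !andbT => /(_ as0 bt0).
  rewrite convRE [X in X `^ _ <= _]convRE /= !dv//.
apply: esum_leP => A fA.
have {}Ha : \sum_(v \in A) a v `^ p <= s `^ p.
  by rewrite -lee_fin -fsumEFin// (le_trans _ Ha)// esum_ub.
have {}Hb : \sum_(v \in A) b v `^ p <= t `^ p.
  by rewrite -lee_fin -fsumEFin// (le_trans _ Hb)// esum_ub.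
rewrite fsumEFin// lee_fin.
set c1 := (s + t) `^ p * (l * (s `^ p)^-1) in pt.
set c2 := (s + t) `^ p * ((1 - l) * (t `^ p)^-1) in pt.
have c10 : 0 <= c1 by apply: mulr_ge0; [exact: powR_ge0|apply: mulr_ge0 => //; rewrite invr_ge0 powR_ge0].
have c20 : 0 <= c2 by apply: mulr_ge0; [exact: powR_ge0|rewrite mulr_ge0 ?subr_ge0 ?invr_ge0 ?powR_ge0].
apply: (@le_trans _ _ (\sum_(v \in A) (c1 * a v `^ p + c2 * b v `^ p))).
  rewrite -lee_fin -!fsumEFin//.
  by apply: lee_fsum => // v _; rewrite lee_fin; exact: pt.
rewrite fsbig_split//= -!mulr_fsumr.
apply: (@le_trans _ _ (c1 * s `^ p + c2 * t `^ p)).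
  by rewrite lerD// ler_wpM2l.
have sp0 : s `^ p != 0 by rewrite gt_eqF// powR_gt0.
have tp0 : t `^ p != 0 by rewrite gt_eqF// powR_gt0.
rewrite [leLHS](_ : _ = (s + t) `^ p)// /c1 /c2.
by field; rewrite sp0 tp0.
Qed.

Lemma kind_mem0 K : kind_mem K (fun=> 0).
Proof.
case: K => [p p1|d d0] /=.
  have p0 : 0 < p by rewrite (lt_le_trans _ p1).
  by rewrite esum1 ?ltry// => v _; rewrite powR0 ?gt_eqF.
rewrite (_ : [set _ | _] = set0) // -subset0 => v /=.
by rewrite leNgt d0.
Qed.

Lemma kind_mem_bound K a : kind_mem K a -> exists c : R, forall v, a v <= c.
Proof.
case: K => [p p1|] /=.
  move=> /(ell_norm p1); set N := fine _ `^ _ => HN; exists N => v.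
  have p0 : 0 < p by rewrite (lt_le_trans _ p1).
  rewrite leNgt; apply/negP => lt.
  have /(_ (finite_set1 v)) := @esum_ub (fun v => a v `^ p) [set v].
  rewrite fsbig_set1 HN lee_fin leNgt gt0_ltr_powR// ?nnegrE ?powR_ge0//.
  by rewrite (le_trans _ (ltW lt))// powR_ge0.
move=> /(_ 1 ltr01) fA.
exists (1 + \sum_(v \in [set v | 1 <= a v]) a v) => v.
have [av1|av1] := leP 1 (a v).
  rewrite (@fsbigD1 _ _ _ _ v)//=.
  rewrite addrCA lerDl addr_ge0//.
  apply: fsumr_ge0 => u [/= au1 _].
  by rewrite (le_trans ler01).
rewrite (le_trans (ltW av1))// lerDl.
by apply: fsumr_ge0 => u /= au1; rewrite (le_trans ler01).
Qed.

Lemma kind_norm_ub K a v : kind_mem K a -> a v <= kind_norm K a.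
Proof.
case: K => [p p1|] /= H.
  have p0 : 0 < p by rewrite (lt_le_trans _ p1).
  rewrite leNgt; apply/negP => lt.
  have /(_ (finite_set1 v)) := @esum_ub (fun v => a v `^ p) [set v].
  rewrite fsbig_set1 (ell_norm p1 H) lee_fin leNgt gt0_ltr_powR//.
    by rewrite nnegrE powR_ge0.
  by rewrite nnegrE (le_trans _ (ltW lt))// powR_ge0.
have [c cP] := @kind_mem_bound (c_zero R) a H.
by apply: ub_le_sup; [exists c => _ [u _ <-]|exists v].
Qed.

Let sup_le a (c : R) : 0 <= c -> (forall v, a v <= c) -> sup (range a) <= c.
Proof.
move=> c0 ac; have [->|/set0P ne] := eqVneq (range a) set0.
  by rewrite sup0.
by apply: ge_sup => // _ [v _ <-].
Qed.

Lemma kind_norm_ge0 K a : (forall v, 0 <= a v) -> 0 <= kind_norm K a.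
Proof.
case: K => [p p1|] a0 /=; first exact: powR_ge0.
have [hs|/sup_out -> //] := pselect (has_sup (range a)).
have [[_ [v _ _]] ubs] := hs.
by rewrite (le_trans (a0 v))//; apply: ub_le_sup => //; exists v.
Qed.

Lemma kind_triangle K a b h :
  (forall v, 0 <= a v) -> (forall v, 0 <= b v) ->
  (forall v, 0 <= h v <= a v + b v) -> kind_mem K a -> kind_mem K b ->
  kind_mem K h /\ kind_norm K h <= kind_norm K a + kind_norm K b.
Proof.
move=> a0 b0 hab Ma Mb.
have Na0 := @kind_norm_ge0 K a a0; have Nb0 := @kind_norm_ge0 K b b0.
case: K Ma Mb Na0 Nb0 => [p p1|] /=.
  move=> /(ell_norm p1) Ma /(ell_norm p1) Mb.
  move: Ma Mb.
  set Na := fine _ `^ _; set Nb := fine (esum _ (fun v => (b v `^ _)%:E)) `^ _.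
  move=> Ma Mb; clearbody Na Nb => Na0 Nb0.
  have p0 : 0 < p by rewrite (lt_le_trans _ p1).
  have key (e : R) : 0 < e ->
      (\esum_(v in [set: I]) (h v `^ p)%:E <= ((Na + e + (Nb + e)) `^ p)%:E)%E.
    move=> e0; apply: (ell_conv p1 _ _ a0 b0 hab).
    - by rewrite ltr_wpDl.
    - by rewrite ltr_wpDl.
    - rewrite Ma lee_fin ge0_ler_powR ?(ltW p0)// ?nnegrE ?addr_ge0 ?(ltW e0)//.
      by rewrite lerDl ltW.
    - rewrite Mb lee_fin ge0_ler_powR ?(ltW p0)// ?nnegrE ?addr_ge0 ?(ltW e0)//.
      by rewrite lerDl ltW.
  split.
    by apply: (le_lt_trans (key 1 ltr01)); exact: ltry.
  apply/ler_addgt0Pr => e e0.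
  have e20 : 0 < e / 2 by rewrite divr_gt0.
  have [|_] := ell_le p1 _ (key _ e20); first by rewrite !addr_ge0 ?(ltW e20).
  by rewrite addrACA -splitr.
move=> Ma Mb Na0 Nb0; split.
  move=> d d0; have d20 : 0 < d / 2 by rewrite divr_gt0.
  apply: (@sub_finite_set _ _ ([set v | d / 2 <= a v] `|` [set v | d / 2 <= b v])).
    move=> v /= dh; have /andP[_ /(le_trans dh)] := hab v.
    have [|lta] := leP (d / 2) (a v); first by left.
    have [|ltb] := leP (d / 2) (b v); first by right.
    by rewrite leNgt [ltRHS]splitr ltrD.
  by rewrite finite_setU; split; [exact: Ma|exact: Mb].
apply: sup_le => [|v]; first exact: addr_ge0.
have /andP[_ /le_trans->//] := hab v.
apply: lerD; [exact: (@kind_norm_ub (c_zero R) a v)|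
              exact: (@kind_norm_ub (c_zero R) b v)].
Qed.

Lemma kind_scale K a (c : R) : (forall v, 0 <= a v) -> 0 <= c ->
  kind_mem K a -> kind_mem K (fun v => c * a v) /\
  kind_norm K (fun v => c * a v) <= c * kind_norm K a.
Proof.
move=> a0 c0 Ma; have Na0 := @kind_norm_ge0 K a a0.
case: K Ma Na0 => [p p1|] /=.
  move=> /(ell_norm p1); set Na := fine _ `^ _ => Ma Na0.
  apply: ell_le => //; first exact: mulr_ge0.
  apply: esum_leP => A fA; rewrite fsumEFin// lee_fin.
  under eq_fsbigr do rewrite powRM//.
  rewrite -mulr_fsumr powRM// ler_wpM2l ?powR_ge0//.
  by rewrite -lee_fin -fsumEFin// -Ma esum_ub.
move=> Ma Na0; split.
  move=> d d0; have [->|c_neq0] := eqVneq c 0.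
    rewrite (_ : [set _ | _] = set0) // -subset0 => v /=.
    by rewrite mul0r leNgt d0.
  have cgt0 : 0 < c by rewrite lt_neqAle eq_sym c_neq0.
  apply: sub_finite_set (Ma (d / c) (divr_gt0 d0 cgt0)) => v /=.
  by rewrite ler_pdivrMr// mulrC.
apply: sup_le => [|v]; first exact: mulr_ge0.
by rewrite ler_wpM2l//; exact: (@kind_norm_ub (c_zero R) a v).
Qed.

End moduli.

Section weighted_space.
Context {R : realType} {I : choiceType}.
Variables (K : space_kind R) (mu : weight R I).
Implicit Types f g : I -> R[i].

(* normc is the modulus as an element of R; `|z| is its image in R[i]. *)
Definition modulus f : I -> R := fun v => normc (mu v * f v).

Definition in_space : {pred (I -> R[i])} :=
  mem [set f | kind_mem K (modulus f)].

Let normcE (z : R[i]) : `|z| = (normc z)%:C. Proof. by []. Qed.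

Let normc_ge0 (z : R[i]) : 0 <= normc z.
Proof. by case: z => x y; rewrite /= sqrtr_ge0. Qed.

Let modulus_ge0 f v : 0 <= modulus f v. Proof. exact: normc_ge0. Qed.

Let modulusD f g v : 0 <= modulus (f + g) v <= modulus f v + modulus g v.
Proof.
rewrite modulus_ge0 /= /modulus (_ : (f + g) v = f v + g v)// mulrDr.
exact: (@le_normcD R).
Qed.

Let modulusZ (c : R[i]) f : modulus (c *: f) = fun v => normc c * modulus f v.
Proof.
apply/funext => v; rewrite /modulus (_ : (c *: f) v = c * f v)// mulrCA.
by rewrite normcM.
Qed.

Lemma in_space_submod_closed : submod_closed in_space.
Proof.
split.
  rewrite inE /= (_ : modulus 0 = fun=> 0); first exact: kind_mem0.
  by apply/funext => v; rewrite /modulus (_ : (0 : I -> R[i]) v = 0)// mulr0 normc0.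
move=> c f g; rewrite !inE /= => Mf Mg.
have [Mcf _] := @kind_scale _ _ K _ (normc c) (modulus_ge0 f) (normc_ge0 c) Mf.
rewrite -modulusZ in Mcf.
by case: (kind_triangle (modulus_ge0 (c *: f)) (modulus_ge0 g)
           (modulusD _ _) Mcf Mg).
Qed.

HB.instance Definition _ :=
  GRing.isSubmodClosed.Build _ _ in_space in_space_submod_closed.

Record wspace : predArgType := WSpace {
  wspace_fun :> I -> R[i];
  wspace_funP : wspace_fun \in in_space }.

HB.instance Definition _ := [isSub for wspace_fun].
HB.instance Definition _ := [Choice of wspace by <:].
HB.instance Definition _ := [SubChoice_isSubLmodule of wspace by <:].

Definition wnorm (f : wspace) : R := kind_norm K (modulus f).

Let wspaceP (f : wspace) : kind_mem K (modulus f).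
Proof. by have := wspace_funP f; rewrite inE. Qed.

Let wnormC_D (f g : wspace) :
  (wnorm (f + g))%:C <= (wnorm f)%:C + (wnorm g)%:C.
Proof.
rewrite -rmorphD/= lecR.
by case: (kind_triangle (modulus_ge0 f) (modulus_ge0 g)
           (modulusD _ _) (wspaceP f) (wspaceP g)).
Qed.

Let wnormZ_le (c : R[i]) (f : wspace) : wnorm (c *: f) <= normc c * wnorm f.
Proof.
rewrite /wnorm (_ : wspace_fun (c *: f) = c *: wspace_fun f)// modulusZ.
by case: (@kind_scale _ _ K _ (normc c) (modulus_ge0 f) (normc_ge0 c) (wspaceP f)).
Qed.

Let wnorm_ge0 (f : wspace) : 0 <= wnorm f.
Proof. exact/kind_norm_ge0/modulus_ge0. Qed.

Let wnormC_Z (c : R[i]) (f : wspace) :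
  (wnorm (c *: f))%:C = `|c| * (wnorm f)%:C.
Proof.
rewrite normcE -rmorphM/=; congr (_%:C).
apply/eqP; rewrite eq_le wnormZ_le /=.
have [->|c0] := eqVneq c 0; first by rewrite normc0 mul0r wnorm_ge0.
have nc0 : 0 < normc c.
  rewrite lt_neqAle normc_ge0 andbT eq_sym.
  by apply: contra c0 => /eqP/eq0_normc ->.
have := wnormZ_le c^-1 (c *: f).
by rewrite scalerA mulVf// scale1r normcV ler_pdivlMl.
Qed.

Let wnormC_eq0 (f : wspace) : (wnorm f)%:C = 0 -> f = 0.
Proof.
move=> [f0]; apply/val_inj/funext => v /=.
have : modulus f v <= 0 by rewrite -f0; exact/kind_norm_ub/wspaceP.
move=> le0; have /eq0_normc/eqP : normc (mu v * f v) = 0.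
  by apply/eqP; rewrite eq_le le0 modulus_ge0.
by rewrite mulf_eq0 (negbTE (weight_neq0 mu v)) /= => /eqP.
Qed.

HB.instance Definition _ := Lmodule_isNormed.Build R[i] wspace
  wnormC_D wnormC_Z wnormC_eq0.

(* Norms over the scalar field R[i] take their values in R[i]. *)
Lemma wspace_normE (f : wspace) : `|f| = (wnorm f)%:C.
Proof. by []. Qed.

End weighted_space.

Definition bounded_operator (R : realType) (X : normedModType R[i])
    (T : {linear X -> X}) : Prop :=
  exists C : R, forall f : X, `|T f| <= C%:C * `|f|.

Definition Furstenberg_family (F : set (set nat)) : Prop :=
  [/\ F !=set0, forall A, F A -> infinite_set A
    & forall A C : set nat, F A -> A `<=` C -> F C].

Definition enlarged (F : set (set nat)) : set (set nat) :=
  [set A | forall N : nat, exists2 D, F D &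
    [set n : nat | exists2 d : nat, D d &
       exists2 k : int, - N%:Z <= k <= N%:Z & n%:Z = d%:Z + k] `<=` A].

Definition return_set (X : Type) (T : X -> X) (U V : set X) : set nat :=
  [set n | (iter n T @` U) `&` V !=set0].

Definition F_transitive (X : topologicalType) (F : set (set nat)) (T : X -> X) :=
  forall U V : set X, open U -> open V -> U !=set0 -> V !=set0 ->
    F (return_set T U V).

Definition topologically_F_recurrent (X : topologicalType)
    (F : set (set nat)) (T : X -> X) :=
  forall U : set X, open U -> U !=set0 -> F (return_set T U U).

(* With the row index shifted by one, the exponent m - i is m - v.1.+1. *)
Definition small_times (R : realType) m (mu : lattice m -> R[i])
    (E : set (lattice m)) (eps : R) : set nat :=
  \bigcap_(v in E) [set n : nat | (0 < n)%N /\
    n%:R ^+ (m - v.1.+1) *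
      (normc (mu (v.1, v.2 + n%:Z)) + normc (mu (v.1, v.2 - n%:Z))) < eps].

(* Main.v *)
(* Write [B = S + D] with [S] the horizontal and [D] the (nilpotent) vertical
   shift. Then [B^n] is [\sum_(r < m) 'C(n, r) D^r S^(n-r)], and on finitely
   supported functions it has the right inverse
   [\sum_(r < m) (-1)^r 'C(n+r-1, r) D^r S^(-n-r)]; both binomials are of order
   [n^r].
   Sufficiency: if the weights at [(i, j + n)] and [(i, j - n)] are smaller than
   [e / n^(m - i)] on a large box, both operators are small on a given finitely
   supported function; adding to a point of U a small preimage under [B^n] of a
   point of V gives [n \in N(U, V)].
   Necessity: if [f] is near the indicator [f0] of a segment of the last row and
   [B^n f] is near [M f0], only the term of order [n^(m - i)] of the two formulas
   is not small, so the entries of [f] at [(i, j + n)] and of [B^n f] at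
   [(i, j - n)] are at least of this order, although [f0] vanishes there. With
   [M = 1] this uses recurrence only; [M = 3] excludes small [n]. *)
Require Import Defs.
From mathcomp Require Import all_boot all_order all_algebra.
From mathcomp Require Import all_classical all_reals all_analysis.
From mathcomp Require Import complex zify ring lra.
Import Order.TTheory GRing.Theory Num.Theory.
Import numFieldNormedType.Exports.
Import ComplexField.Normc.

Set Implicit Arguments.
Unset Strict Implicit.
Unset Printing Implicit Defensive.

Local Open Scope classical_set_scope.
Local Open Scope ring_scope.
Local Open Scope complex_scope.

(** * Binomial coefficients of positive and negative order *)

(* The binomial coefficient of [-n] over [r]; the truncation at [n = r = 0] is
   harmless, as ['C(0, 0) = 1]. *)
Definition neg_bin (A : pzRingType) (n r : nat) : A :=
  (-1) ^+ r * 'C((n + r).-1, r)%:R.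

Lemma neg_bin0 (A : pzRingType) (n : nat) : neg_bin A n 0 = 1.
Proof. by rewrite /neg_bin expr0 bin0 mulr1. Qed.

(** Compares coefficients in [(1 + X)^(-n) = (1 + X) (1 + X)^(-n-1)]. *)
Lemma neg_binS (A : pzRingType) (n r : nat) :
  neg_bin A n r.+1 = neg_bin A n.+1 r.+1 + neg_bin A n.+1 r.
Proof.
rewrite /neg_bin !addSn !addnS /= binS natrD exprS mulN1r mulrDr.
by rewrite (mulNr _ 'C(n + r, r)%:R) addrNK.
Qed.

(* Multiplication of the series [\sum_r a r *: X^r] by [1 + X], read off on
   a family [x] that plays the role of the powers of [X] modulo [X^L]. *)
Lemma sum_pascal (A : pzRingType) (W : lmodType A) (a b : nat -> A)
    (x : nat -> W) (L : nat) :
  b 0 = a 0 -> (forall r, b r.+1 = a r.+1 + a r) -> x L = 0 ->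
  \sum_(r < L) a r *: (x r + x r.+1) = \sum_(r < L) b r *: x r.
Proof.
move=> b0 bS; case: L => [|L] xL; first by rewrite !big_ord0.
(* Truncating the product leaves a boundary term, which the induction on the length has to carry
   since only the last [x] vanishes. *)
suff -> : \sum_(r < L.+1) a r *: (x r + x r.+1) =
          \sum_(r < L.+1) b r *: x r + a L *: x L.+1.
  by rewrite xL scaler0 addr0.
elim: L {xL} => [|L IH]; first by rewrite !big_ord1 /= b0 scalerDr.
rewrite big_ord_recr IH [in RHS]big_ord_recr /= bS scalerDl scalerDr.
by rewrite addrACA -!addrA; congr (_ + _); rewrite addrCA.
Qed.

Lemma sum_unit (A : pzRingType) (W : lmodType A) (a : nat -> A)
    (x : nat -> W) (L : nat) :
  a 0 = 1 -> (forall r, a r.+1 = 0) -> x L = 0 ->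
  \sum_(r < L) a r *: x r = x 0.
Proof.
move=> a0 aS; case: L => [|L] xL; first by rewrite big_ord0 xL.
by rewrite big_ord_recl a0 scale1r big1 ?addr0// => r _; rewrite aS scale0r.
Qed.

Lemma neg_bin0S (A : pzRingType) (r : nat) : neg_bin A 0 r.+1 = 0.
Proof. by rewrite /neg_bin add0n /= bin_small// mulr0. Qed.

Lemma bin_leX (n r : nat) : ('C(n, r) <= n ^ r)%N.
Proof.
rewrite (@leq_trans ('C(n, r) * r`!)%N) ?leq_pmulr ?fact_gt0// bin_ffact.
elim: r => [|r IH]; first by rewrite ffactn0.
by rewrite ffactnSr expnSr leq_mul ?leq_subr.
Qed.

(** By [mul_bin_diag], passing from [r] to [r.+1] multiplies by [(n + r) / (r + 1)], which is at
    most [n] for [n >= 1]. *)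
Lemma neg_bin_leX (n r : nat) : (0 < n)%N -> ('C((n + r).-1, r) <= n ^ r)%N.
Proof.
move=> n0; elim: r => [|r IH]; first by rewrite bin0.
rewrite -(leq_pmul2l (ltn0Sn r)) addnS /= -mul_bin_diag.
rewrite expnS mulnA leq_mul//; nia.
Qed.

(** Each of the [k] factors of the falling factorial is at least [n / 2]. The constant depends on
    [m] only, so one value serves all rows and [neg_bin_geX] as well. *)
Lemma bin_geX (n k m : nat) : (k <= m)%N -> (2 * k <= n)%N ->
  (n ^ k <= 2 ^ m * m`! * 'C(n, k))%N.
Proof.
move=> km kn; rewrite (@leq_trans (2 ^ k * k`! * 'C(n, k))%N) //; last first.
  by rewrite leq_mul// leq_mul ?leq_pexp2l ?leq_fact.
rewrite -mulnA (mulnC k`!) bin_ffact.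
elim: k {km} kn => [|k IH] kn; first by rewrite ffactn0.
rewrite ffactnSr !expnSr mulnACA leq_mul ?IH//; lia.
Qed.

Lemma neg_bin_geX (n k m : nat) : (k <= m)%N ->
  (n ^ k <= 2 ^ m * m`! * 'C((n + k).-1, k))%N.
Proof.
move=> km; rewrite (@leq_trans (k`! * 'C((n + k).-1, k))%N) //; last first.
  by rewrite leq_mul// (leq_trans (leq_fact km))// leq_pmull ?expn_gt0.
elim: k {km} => [|k IH]; first by rewrite bin0.
rewrite factS addnS /= (mulnC k.+1) -mulnA -mul_bin_diag expnSr.
by rewrite mulnCA mulnC leq_mul// leq_addr.
Qed.

(** * Moduli in [R[i]] and the dominant term of a sum *)

Section normc_facts.
Context {R : realType}.
Implicit Types z w : R[i].

Lemma normc_normE z : `|z| = (normc z)%:C. Proof. by []. Qed.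

Lemma normc_ge0 z : 0 <= normc z.
Proof. by rewrite -lecR -normc_normE normr_ge0. Qed.

Lemma normc_gt0 z : z != 0 -> 0 < normc z.
Proof. by rewrite -ltcR -normc_normE normr_gt0. Qed.

Lemma normc_nat n : normc (n%:R : R[i]) = n%:R.
Proof.
by apply: complexI; rewrite -normc_normE normr_nat rmorph_nat.
Qed.

Lemma normc_sign n : normc ((-1) ^+ n : R[i]) = 1.
Proof. by apply: complexI; rewrite -normc_normE normrX normrN1 expr1n. Qed.

Lemma normc_leB z w : normc z - normc w <= normc (z - w).
Proof. by rewrite -lecR rmorphB /= -!normc_normE lerB_dist. Qed.

Lemma normc_sub z w : normc (z - w) = normc (w - z).
Proof. by apply: complexI; rewrite -!normc_normE distrC. Qed.

Lemma normc_sum (I : Type) (s : seq I) (P : pred I) (f : I -> R[i]) :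
  normc (\sum_(i <- s | P i) f i) <= \sum_(i <- s | P i) normc (f i).
Proof. by rewrite -lecR rmorph_sum /= -normc_normE ler_norm_sum. Qed.

Lemma normc_neg_bin n r : normc (neg_bin R[i] n r) = 'C((n + r).-1, r)%:R.
Proof. by rewrite normcM normc_sign normc_nat mul1r. Qed.

(** The term of index [k] is at least [kap * n^k * (1 - d)], the earlier ones add up to at most
    [m * d * n^k], and the later ones vanish. The bound on [d] keeps the loss [kap * d + m * d]
    below half of [kap]. *)
Lemma dominant_term (k m n : nat) (a y : nat -> R[i]) (kap d : R) :
  (k < m)%N -> 0 <= kap <= 1 -> 0 <= d -> d * m.+1%:R * 2 <= kap ->
  (forall r, (r < k)%N -> normc (a r) <= n%:R ^+ k) ->
  kap * n%:R ^+ k <= normc (a k) ->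
  (forall r, (r < k)%N -> normc (y r) <= d) -> 1 - d <= normc (y k) ->
  (forall r, (k < r)%N -> y r = 0) ->
  kap / 2 * n%:R ^+ k <= normc (\sum_(r < m) a r * y r).
Proof.
move=> km /andP[kap0 kap1] d0 hd a_le a_ge y_le y_ge y0.
rewrite (bigID (fun r : 'I_m => (r < k)%N)) /=.
rewrite [X in _ + X](bigD1 (Ordinal km)) /= ?ltnn//.
rewrite [X in _ + (_ + X)]big1 ?addr0; last first.
  move=> r /andP[]; rewrite -leqNgt leq_eqVlt => /predU1P[kr|kr _].
    by case/eqP; apply/val_inj.
  by rewrite y0// mulr0.
have nk0 : 0 <= n%:R ^+ k :> R by rewrite exprn_ge0.
set S := \sum_(_ < _ | _) _.
have S_le : normc S <= m%:R * (n%:R ^+ k * d).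
  apply: le_trans (normc_sum _ _ _) _.
  have -> : m%:R * (n%:R ^+ k * d) = \sum_(r < m) n%:R ^+ k * d.
    by rewrite sumr_const card_ord mulr_natl.
  rewrite [leRHS](bigID (fun r : 'I_m => (r < k)%N)) /= ler_wpDr//.
    by apply: sumr_ge0 => r _; rewrite mulr_ge0.
  apply: ler_sum => r rk; rewrite normcM ler_pM ?normc_ge0//.
    exact: a_le.
  exact: y_le.
have T_ge : kap * n%:R ^+ k * (1 - d) <= normc (a k * y k).
  rewrite normcM; apply: (@le_trans _ _ (kap * n%:R ^+ k * normc (y k))).
    by rewrite ler_wpM2l// mulr_ge0.
  by rewrite ler_wpM2r ?normc_ge0.
have := normc_leB (a k * y k) (- S).
rewrite opprK addrC (_ : normc (- S) = normc S); last first.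
  by rewrite -sub0r normc_sub subr0.
move=> /(le_trans _); apply.
rewrite lerBrDr (le_trans _ T_ge)// -lerBrDl.
apply: le_trans S_le _; rewrite mulrCA.
rewrite (_ : _ - _ = n%:R ^+ k * (kap * (1 - d) - kap / 2)); last by ring.
rewrite ler_wpM2l// mulrC; have : kap * d <= d by rewrite ler_piMl.
move: hd; rewrite -natr1; lra.
Qed.

End normc_facts.

(** * Density of finitely supported functions *)

Section moduli_facts.
Context {R : realType} {I : choiceType}.
Implicit Types (K : space_kind R) (a : I -> R).

Lemma esum_powR_le (p c : R) a : 1 <= p -> 0 <= c ->
  (\esum_(v in [set: I]) (a v `^ p)%:E <= (c `^ p)%:E)%E ->
  (\esum_(v in [set: I]) (a v `^ p)%:E < +oo)%E /\
  fine (\esum_(v in [set: I]) (a v `^ p)%:E)%E `^ p^-1 <= c.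
Proof.
move=> p1 c0 H; have p0 : 0 < p by rewrite (lt_le_trans _ p1).
have Hoo := le_lt_trans H (ltry _); split => //.
have S0 : (0 <= \esum_(v in [set: I]) (a v `^ p)%:E)%E.
  by apply: esum_ge0 => v _; rewrite lee_fin powR_ge0.
rewrite -[leRHS](powRr1 c0) -(mulfV (lt0r_neq0 p0)) powRrM.
rewrite ge0_ler_powR ?invr_ge0 ?(ltW p0)// ?nnegrE ?fine_ge0 ?powR_ge0//.
by rewrite -lee_fin fineK// ge0_fin_numE.
Qed.

Lemma kind_single K (v : I) (c : R) : 0 <= c ->
  kind_mem K (fun u => if u == v then c else 0) /\
  kind_norm K (fun u => if u == v then c else 0) <= c.
Proof.
move=> c0; case: K => [p p1|] /=.
  have p0 : 0 < p by rewrite (lt_le_trans _ p1).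
  apply: esum_powR_le => //.
  rewrite (_ : \esum_(_ in _) _ = \esum_(u in [set v]) (c `^ p)%:E)%E.
    by rewrite esum_set1// lee_fin powR_ge0.
  rewrite [RHS]esum_mkcond; apply: eq_esum => u _.
  have [->|uv] := eqVneq u v; first by rewrite mem_set.
  by rewrite memNset ?powR0 ?gt_eqF// => /= /eqP; rewrite (negbTE uv).
split.
  move=> d d0; apply: sub_finite_set (finite_set1 v) => u /=.
  by have [//|_] := eqVneq u v; rewrite leNgt d0.
apply: ge_sup; first by exists (if v == v then c else 0); exists v.
by move=> _ [u _ <-]; case: ifP.
Qed.

(** For [ell_p] the list exhausts the sum of the [p]-th powers up to [e ^ p]; for [c_zero] it
    collects the finitely many points where [a] is at least [e]. *)
Lemma kind_tail K a (e : R) : (forall v, 0 <= a v) -> kind_mem K a -> 0 < e ->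
  exists s : seq I, kind_norm K (fun v => if v \in s then 0 else a v) <= e.
Proof.
move=> a0; case: K => [p p1|] /= Ma e0.
  have p0 : 0 < p by rewrite (lt_le_trans _ p1).
  set b := fun v => (a v `^ p)%:E.
  have b0 v : (0 <= b v)%E by rewrite lee_fin powR_ge0.
  have Sfin : esum [set: I] b \is a fin_num.
    rewrite ge0_fin_numE; [exact: Ma|by apply: esum_ge0 => v _; exact: b0].
  have ep0 : 0 < e `^ p by rewrite powR_gt0.
  have [_ [A [fA _] <-] Alt] := ub_ereal_sup_adherent ep0 Sfin.
  have [s sE] := (finite_seqP A).1 fA; exists s.
  apply: (esum_powR_le p1 (ltW e0) _).2.
  rewrite (_ : esum _ _ = esum ([set: I] `&` ~` A) b); last first.
    rewrite esum_mkcondr; apply: eq_esum => v _; rewrite in_setC sE.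
    have [vs|vs] := boolP (v \in s); first by rewrite mem_set//= powR0 ?gt_eqF.
    by rewrite memNset//=; exact/negP.
  move: Sfin Alt; rewrite -/(esum [set: I] b) (esumID A); last by move=> v _; exact: b0.
  rewrite setTI (esum_fset fA); last by move=> v _; exact: b0.
  case: (\sum_(_ \in A) _)%E => [x| |]; case: (esum _ _) => [y| |] //= _.
  by rewrite lte_fin lee_fin => /ltW; lra.
have /finite_seqP [s sE] := Ma e e0; exists s.
have [->|/set0P ne] := eqVneq (range (fun v => if v \in s then 0 else a v)) set0.
  by rewrite sup0 ltW.
apply: ge_sup => //.
move=> _ [v _ <-]; have [|/negP vs] := boolP (v \in s); first by rewrite ltW.
rewrite leNgt; apply/negP => /ltW ev; apply: vs.
by have : [set v | e <= a v] v by []; rewrite sE.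
Qed.

End moduli_facts.

Section wspace_facts.
Context {R : realType} {I : choiceType} {K : space_kind R} {mu : weight R I}.
Implicit Types f g : wspace K mu.

Lemma wspace_funD f g v : (f + g : wspace K mu) v = f v + g v.
Proof. by []. Qed.

Lemma wspace_funZ (c : R[i]) f v : (c *: f : wspace K mu) v = c * f v.
Proof. by []. Qed.

Lemma wspace_funB f g v : (f - g : wspace K mu) v = f v - g v.
Proof. by []. Qed.

Lemma wspace_fun_sum (J : Type) (s : seq J) (P : pred J)
    (F : J -> wspace K mu) v :
  (\sum_(k <- s | P k) F k : wspace K mu) v = \sum_(k <- s | P k) F k v.
Proof. exact: (big_morph (fun f => f v) (fun f g => wspace_funD f g v)). Qed.

Lemma wnorm_ge0 f : 0 <= wnorm f.
Proof. by rewrite -lecR -wspace_normE normr_ge0. Qed.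

Lemma wnormD f g : wnorm (f + g) <= wnorm f + wnorm g.
Proof. by rewrite -lecR rmorphD /= -!wspace_normE ler_normD. Qed.

Lemma wnormZ (c : R[i]) f : wnorm (c *: f) = normc c * wnorm f.
Proof. by apply: complexI; rewrite rmorphM /= -wspace_normE normrZ. Qed.

Lemma wnorm0 : wnorm (0 : wspace K mu) = 0.
Proof. by apply: complexI; rewrite -wspace_normE normr0. Qed.

Lemma wnormN f : wnorm (- f) = wnorm f.
Proof. by apply: complexI; rewrite -!wspace_normE normrN. Qed.

Lemma wnorm_sum (J : Type) (s : seq J) (P : pred J) (F : J -> wspace K mu) :
  wnorm (\sum_(k <- s | P k) F k) <= \sum_(k <- s | P k) wnorm (F k).
Proof.
by rewrite -lecR rmorph_sum /= -wspace_normE ler_norm_sum.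
Qed.

Lemma modulus_le_wnorm f v : normc (mu v * f v) <= wnorm f.
Proof.
by apply: (kind_norm_ub (a := modulus mu f)); have := wspace_funP f; rewrite inE.
Qed.

Lemma open_wnormP (U : set (wspace K mu)) f : open U -> U f ->
  exists2 d : R, 0 < d & forall g, wnorm (f - g) < d -> U g.
Proof.
move=> oU Uf; have /nbhs_ballP [e /= e0 eU] : nbhs f U by exact: open_nbhs_nbhs.
(* Radii live in [R[i]]; a positive one is real. *)
have eE : e = (complex.Re e)%:C by rewrite (RRe_real (gtr0_real e0)).
exists (complex.Re e); first by rewrite -ltcR -eE.
move=> g fg; apply: eU; rewrite -ball_normE /= wspace_normE eE.
by rewrite ltcR.
Qed.

Lemma wball_open f (d : R) : open [set g | wnorm (f - g) < d].
Proof.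
rewrite (_ : [set _ | _] = ball f (d%:C)); first exact: ball_open.
by apply/funext => g; rewrite -ball_normE /= wspace_normE ltcR.
Qed.

Lemma modulus_delta (v : I) :
  modulus mu (fun u => (u == v)%:R) = fun u => if u == v then normc (mu v) else 0.
Proof.
apply/funext => u; rewrite /modulus; have [->|_] := eqVneq u v.
  by rewrite mulr1.
by rewrite mulr0 normc0.
Qed.

Lemma delta_in_space (v : I) : (fun u => (u == v)%:R) \in in_space K mu.
Proof. by rewrite inE /= modulus_delta; case: (kind_single K v (normc_ge0 (mu v))). Qed.

Definition wdelta (v : I) : wspace K mu := WSpace (delta_in_space v).

Lemma wnorm_delta v : wnorm (wdelta v) <= normc (mu v).
Proof.
by rewrite /wnorm /= modulus_delta; case: (kind_single K v (normc_ge0 (mu v))).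
Qed.

Lemma wdelta_dense f (e : R) : 0 < e ->
  exists s : seq I, wnorm (f - \sum_(v <- s) f v *: wdelta v) <= e.
Proof.
move=> e0; have Mf : kind_mem K (modulus mu f) by have := wspace_funP f; rewrite inE.
have [s hs] := kind_tail (fun v => normc_ge0 _) Mf e0.
(* The list may repeat points, but each delta must enter the sum once. *)
exists (undup s); apply: le_trans hs; rewrite le_eqVlt; apply/orP; left; apply/eqP.
congr (kind_norm K _); apply/funext => u; rewrite /modulus wspace_funB wspace_fun_sum.
case: ifPn => us.
  rewrite (bigD1_seq u) ?mem_undup ?undup_uniq// big1.
    by rewrite wspace_funZ /= addr0 eqxx mulr1 subrr mulr0 normc0.
  by move=> v vu; rewrite wspace_funZ /= eq_sym (negbTE vu) mulr0.
rewrite big_seq big1 ?subr0// => v; rewrite mem_undup wspace_funZ /= => vs.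
by have [uv|_] := eqVneq u v; [rewrite uv vs in us|rewrite mulr0].
Qed.

End wspace_facts.

(** * Powers of the shift *)

Section lattice_shift.
Context {R : realType} {m : nat}.
Implicit Types f : lattice m -> R[i].

(* The rows are counted by [nat], with value 0 below the last row, so that
   the backward shift obeys one recurrence on all rows. *)
Definition ext f (i : nat) (j : int) : R[i] :=
  if insub i is Some k then f (k, j) else 0.

Lemma extE f (k : 'I_m) j : ext f k j = f (k, j).
Proof. by rewrite /ext valK. Qed.

Lemma ext_ge f i j : (m <= i)%N -> ext f i j = 0.
Proof. by move=> mi; rewrite /ext insubF// ltnNge mi. Qed.

Lemma ext_backward_shift f i j :
  ext (backward_shift f) i j = ext f i (j + 1) + ext f i.+1 j.
Proof.
have [im|mi] := ltnP i m; last by rewrite !ext_ge ?addr0// ltnW.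
rewrite -[ i ]/(val (Ordinal im)) extE /backward_shift.
have [i1m|mi1] := ltnP i.+1 m; last first.
  rewrite extE ext_ge// addr0 (_ : Chi _ = [set (Ordinal im, j + 1)]) ?fsbig_set1//.
  apply/seteqP; split => [[k l] /= [[/= -> ->]//|[/= kE _]]|_ ->]; last by left.
  by have := ltn_ord k; rewrite kE ltnNge mi1.
rewrite -[(val (Ordinal im)).+1]/(val (Ordinal i1m)) !extE.
rewrite (_ : Chi _ = [set (Ordinal im, j + 1)] `|` [set (Ordinal i1m, j)]).
  rewrite fsbigU ?fsbig_set1// => x [/= -> [+ _]] .
  by move/eqP; rewrite (ltn_eqF (ltnSn i)).
apply/seteqP; split => [[k l] /= [[/= -> ->]|[/= kE ->]]|_ [->|->]].
- by left.
- by right; congr (_, _); apply/val_inj.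
- by left.
- by right.
Qed.

Context {K : space_kind R} {mu : weight R (lattice m)}.

(* [s] counts the rows from the last one, so it is the exponent of [n] in
   [small_times]. *)
Definition ebas (s : nat) (j : int) : wspace K mu :=
  if insub s is Some k then wdelta (rev_ord k, j) else 0.

Lemma ebas_ge s j : (m <= s)%N -> ebas s j = 0.
Proof. by move=> ms; rewrite /ebas insubF// ltnNge ms. Qed.

Lemma ebas_rev (k : 'I_m) j : ebas (rev_ord k) j = wdelta (k, j).
Proof. by rewrite /ebas valK rev_ordK. Qed.

Lemma ext_ebas s j i l :
  ext (ebas s j) i l = (((i + s).+1 == m) && (l == j))%:R.
Proof.
have [im|mi] := ltnP i m; last first.
  by rewrite ext_ge// gtn_eqF// ltnS (leq_trans mi) ?leq_addr.
rewrite -[ i ]/(val (Ordinal im)) extE /=.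
have [sm|ms] := ltnP s m; last first.
  by rewrite ebas_ge// gtn_eqF// ltnS (leq_trans ms) ?leq_addl.
rewrite -[s]/(val (Ordinal sm)) -[Ordinal sm]rev_ordK ebas_rev /=.
congr (_%:R); rewrite xpair_eqE -val_eqE /=; congr (nat_of_bool (_ && _)).
by apply/eqP/eqP; lia.
Qed.

Lemma ext_inj (f g : wspace K mu) :
  (forall i j, ext f i j = ext g i j) -> f = g.
Proof.
by move=> fg; apply/val_inj/funext => -[k j] /=; have := fg k j; rewrite !extE.
Qed.

Lemma extD (f g : wspace K mu) i j : ext (f + g) i j = ext f i j + ext g i j.
Proof. by rewrite /ext; case: insub => [k|]; rewrite ?addr0. Qed.

Context (B : {linear wspace K mu -> wspace K mu}).
Context (B_shift : forall f : wspace K mu,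
  wspace_fun (B f) = backward_shift (wspace_fun f)).

Lemma ext_B (f : wspace K mu) i j :
  ext (B f) i j = ext f i (j + 1) + ext f i.+1 j.
Proof. by rewrite B_shift ext_backward_shift. Qed.

Lemma B_ebas s j : B (ebas s j) = ebas s (j - 1) + ebas s.+1 j.
Proof.
apply: ext_inj => i l; rewrite ext_B extD !ext_ebas addSn addnS.
by rewrite -subr_eq opprK.
Qed.

(** The expansion of [(S + D)^n] entry by entry; the terms with [r >= m] fall below the last row, so
    [m] terms suffice for every [n]. *)
Lemma ext_iterB (f : wspace K mu) n i j :
  ext (iter n B f) i j = \sum_(r < m) 'C(n, r)%:R * ext f (i + r) (j + n%:Z - r%:Z).
Proof.
elim: n f => [|n IH] f.
  rewrite (sum_unit (W := R[i]^o) (x := fun r => ext f (i + r) (j + 0%:Z - r%:Z))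
    (a := fun r => 'C(0, r)%:R)).
  - by rewrite addn0; congr ext; lia.
  - by rewrite bin0.
  - by move=> r; rewrite bin0n.
  - by rewrite ext_ge ?leq_addl.
rewrite iterSr IH.
rewrite -(sum_pascal (W := R[i]^o) (a := fun r => 'C(n, r)%:R)
    (b := fun r => 'C(n.+1, r)%:R)
    (x := fun r => ext f (i + r) (j + n.+1%:Z - r%:Z))).
- apply: eq_bigr => r _; rewrite ext_B addnS.
  by congr (_ * (ext _ _ _ + ext _ _ _)); lia.
- by rewrite !bin0.
- by move=> r; rewrite binS natrD.
- by rewrite ext_ge ?leq_addl.
Qed.

(** Since [B^n = S^n (1 + D S^(-1))^n], one has [S^n = (1 + D S^(-1))^(-n) B^n]: the entries of [f]
    are recovered from [B^n f], for arbitrary [f]. *)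
Lemma ext_iterB_inv (f : wspace K mu) n i j :
  ext f i (j + n%:Z) =
  \sum_(r < m) neg_bin R[i] n r * ext (iter n B f) (i + r) (j - r%:Z).
Proof.
elim: n j => [|n IH] j.
  rewrite (sum_unit (W := R[i]^o) (x := fun r => ext f (i + r) (j - r%:Z))
    (a := neg_bin R[i] 0)).
  - by rewrite addn0; congr ext; lia.
  - by rewrite neg_bin0.
  - by move=> r; rewrite neg_bin0S.
  - by rewrite ext_ge ?leq_addl.
rewrite intS addrA IH /=.
rewrite -(sum_pascal (W := R[i]^o) (a := neg_bin R[i] n.+1) (b := neg_bin R[i] n)
    (x := fun r => ext (iter n B f) (i + r) (j + 1 - r%:Z))).
- apply: eq_bigr => r _; rewrite ext_B addnS.
  by congr (_ * (ext _ _ _ + ext _ _ _)); lia.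
- by rewrite !neg_bin0.
- exact: neg_binS.
- by rewrite ext_ge ?leq_addl.
Qed.

Lemma iterB_ebas n s j : iter n B (ebas s j) =
  \sum_(r < m) ('C(n, r)%:R : R[i]) *: ebas (s + r) (j - n%:Z + r%:Z).
Proof.
elim: n => [|n IH].
  rewrite (sum_unit (x := fun r => ebas (s + r) (j - 0%:Z + r%:Z))
    (a := fun r => 'C(0, r)%:R)).
  - by rewrite addn0; congr ebas; lia.
  - by rewrite bin0.
  - by move=> r; rewrite bin0n.
  - by rewrite ebas_ge ?leq_addl.
rewrite iterS IH linear_sum /=.
rewrite -(sum_pascal (a := fun r => 'C(n, r)%:R) (b := fun r => 'C(n.+1, r)%:R)
    (x := fun r => ebas (s + r) (j - n.+1%:Z + r%:Z))).
- apply: eq_bigr => r _; rewrite linearZ /= B_ebas addnS.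
  by congr (_ *: (ebas _ _ + ebas _ _)); lia.
- by rewrite !bin0.
- by move=> r; rewrite binS natrD.
- by rewrite ebas_ge ?leq_addl.
Qed.

Definition ebas_inv n s j : wspace K mu :=
  \sum_(r < m) neg_bin R[i] n r *: ebas (s + r) (j + n%:Z + r%:Z).

Lemma iterB_ebas_inv n s j : iter n B (ebas_inv n s j) = ebas s j.
Proof.
elim: n => [|n IH].
  rewrite /= /ebas_inv (sum_unit (x := fun r => ebas (s + r) (j + 0%:Z + r%:Z))).
  - by rewrite addn0; congr ebas; lia.
  - by rewrite neg_bin0.
  - by move=> r; rewrite neg_bin0S.
  - by rewrite ebas_ge ?leq_addl.
(* [B] maps [ebas_inv n.+1 s j] to [ebas_inv n s j], by the Pascal rule of negative order. *)
rewrite iterSr -[RHS]IH; congr (iter n B _); rewrite /ebas_inv linear_sum /=.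
rewrite -(sum_pascal (a := neg_bin R[i] n.+1) (b := neg_bin R[i] n)
    (x := fun r => ebas (s + r) (j + n%:Z + r%:Z))).
- apply: eq_bigr => r _; rewrite linearZ /= B_ebas addnS.
  by congr (_ *: (ebas _ _ + ebas _ _)); lia.
- by rewrite !neg_bin0.
- exact: neg_binS.
- by rewrite ebas_ge ?leq_addl.
Qed.

End lattice_shift.

(** * Small times over boxes *)

Section small_boxes.
Context {R : realType} {m : nat} {K : space_kind R} {mu : weight R (lattice m)}.

(** Boxes exhaust the finite vertex sets, and a bounded shift of columns takes a box into a larger
    one. *)
Definition box (L : nat) : set (lattice m) := [set v | (`|v.2| <= L)%N].

Lemma finite_box L : finite_set (box L).
Proof.
apply: (@sub_finite_set _ _
  [set (x.1, x.2%:Z - L%:Z) | x in [set: 'I_m * 'I_(2 * L).+1]]).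
  move=> [k j]; rewrite /box /= => jL.
  have jL' : (`|(j + L%:Z)%R| < (2 * L).+1)%N by lia.
  by exists (k, Ordinal jL') => //=; congr (_, _); lia.
exact/finite_image/finite_finset.
Qed.

Lemma finite_sub_box (E : set (lattice m)) : finite_set E ->
  exists L, E `<=` box L.
Proof.
move=> /finite_seqP [s ->]; exists (\sum_(v <- s) `|v.2|)%N => v /= vs.
by rewrite /box /= (big_rem v)//= leq_addr.
Qed.

Lemma small_timesS (E E' : set (lattice m)) (e e' : R) :
  E' `<=` E -> e <= e' -> small_times mu E e `<=` small_times mu E' e'.
Proof.
move=> EE ee n nE v /EE /nE [n0 nv]; split => //; exact: lt_le_trans nv ee.
Qed.

Lemma small_box_ebas L (e : R) n s (j t : int) : 0 <= e ->
  small_times mu (box L) e n -> (`|j| <= L)%N -> (`|t| = n)%N ->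
  n%:R ^+ s * wnorm (ebas s (j + t) : wspace K mu) <= e.
Proof.
move=> e0 nS jL tn; have [ms|sm] := leqP m s.
  by rewrite ebas_ge// wnorm0 mulr0.
have [_ /ltW] := nS (rev_ord (Ordinal sm), j) jL.
apply: le_trans; rewrite (_ : (m - _)%N = s); last by rewrite /=; lia.
rewrite ler_wpM2l ?exprn_ge0//.
rewrite -[s in ebas s]/(val (Ordinal sm)) -[Ordinal sm]rev_ordK ebas_rev rev_ordK.
apply: le_trans (wnorm_delta _) _ => /=.
have [->|->] : t = n%:Z \/ t = - n%:Z by lia.
  by rewrite lerDl normc_ge0.
by rewrite lerDr normc_ge0.
Qed.

(** A coefficient of order [n^r] meets a weight that is small even after multiplication by
    [n^(s + r)], so each term is at most [e]. The sign of [t] covers both [B^n] and its right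
    inverse. *)
Lemma small_box_sum L (e : R) n s (j t : int) (a : nat -> R[i]) : 0 <= e ->
  small_times mu (box L) e n -> (`|j| + m <= L)%N -> (`|t| = n)%N ->
  (0 < n)%N -> (forall r, normc (a r) <= n%:R ^+ r) ->
  wnorm (\sum_(r < m) a r *: ebas (s + r) (j + t + r%:Z) : wspace K mu)
    <= m%:R * e.
Proof.
move=> e0 nS jL tn n0 a_le; apply: (le_trans (wnorm_sum _ _ _)).
have -> : m%:R * e = \sum_(r < m) e by rewrite sumr_const card_ord mulr_natl.
apply: ler_sum => r _; rewrite wnormZ addrAC.
have jr : (`|(j + r%:Z)%R| <= L)%N by have := ltn_ord r; lia.
apply: (le_trans _ (small_box_ebas (s + r) e0 nS jr tn)).
rewrite ler_wpM2r ?wnorm_ge0// (le_trans (a_le r))//.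
by rewrite ler_weXn2l ?leq_addl// ler1n.
Qed.

Lemma box_lower L : exists2 eta : R, 0 < eta &
  forall v, box L v -> eta <= normc (mu v).
Proof.
have [s sE] := (finite_seqP _).1 (finite_box L); rewrite sE.
elim: s {sE} => [|u s [eta eta0 etaP]]; first by exists 1.
exists (Num.min eta (normc (mu u))).
  by rewrite lt_min eta0 normc_gt0// weight_neq0.
move=> v /=; rewrite inE => /predU1P[->|/etaP]; rewrite ge_min ?lexx ?orbT//.
by move=> ->.
Qed.

(* [e'] is taken below the weights of a window, which excludes the times
   [d <= N]: their shifts need not be positive. *)
Lemma small_times_shift (L N : nat) (e : R) : (0 < m)%N -> 0 < e ->
  exists2 e' : R, 0 < e' & forall d n : nat,
    small_times mu (box (L + N)) e' d -> (n <= d + N)%N -> (d <= n + N)%N ->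
    small_times mu (box L) e n.
Proof.
move=> m0 e0; have [eta eta0 etaP] := box_lower N.
(* For [d >= 1], [n <= d + N <= N.+1 * d], so [C] bounds the growth of the factor [n^(m - i)] in
   every row; the [2] below splits [e] between the two weights. *)
pose C : R := N.+1%:R ^+ m; have C0 : 0 < C by rewrite exprn_gt0.
exists (Num.min eta (e / (2 * C))).
  by rewrite lt_min eta0 divr_gt0// mulr_gt0.
move=> d n dS nd dn.
have [d0 _] := dS (Ordinal m0, 0) isT.
have Nd : (N < d)%N.
  rewrite ltnNge; apply/negP => dN; have [_] := dS (Ordinal m0, 0) isT.
  apply/negP; rewrite -leNgt /= ge_min; apply/orP; left.
  have dbox : box N (Ordinal m0, 0 + d%:Z) by rewrite /box /=; lia.
  apply: le_trans (etaP _ dbox) _; rewrite -[leLHS]mul1r ler_pM//.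
  - exact: normc_ge0.
  - by rewrite exprn_ege1// ler1n.
  - by rewrite lerDl normc_ge0.
move=> [k j]; rewrite {1}/box /= => jL; split; first by lia.
have key (z : R) : 0 <= z -> d%:R ^+ (m - k.+1) * z < e / (2 * C) ->
    n%:R ^+ (m - k.+1) * z < e / 2.
  move=> z0 dz; have -> : e / 2 = C * (e / (2 * C)).
    by field; rewrite gt_eqF.
  apply: (@le_lt_trans _ _ (C * (d%:R ^+ (m - k.+1) * z))); last first.
    by rewrite ltr_pM2l.
  rewrite mulrA ler_wpM2r// /C.
  apply: (@le_trans _ _ ((N.+1 * d)%:R ^+ (m - k.+1))).
    by rewrite lerXn2r ?nnegrE// ler_nat; nia.
  rewrite natrM exprMn ler_wpM2r ?exprn_ge0// ler_weXn2l ?leq_subr//.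
  by rewrite ler1n.
rewrite mulrDr [ltRHS]splitr ltrD//; apply: key; rewrite ?normc_ge0//.
(* The weight at column [j + n] is the one reached at time [d] from column [j + n - d] of the wider
   box. *)
- have jb : box (L + N) (k, j + n%:Z - d%:Z) by rewrite /box /=; lia.
  have [_ /=] := dS _ jb; rewrite subrK lt_min => /andP[_]; apply: le_lt_trans.
  by rewrite ler_wpM2l ?exprn_ge0// lerDl normc_ge0.
- have jb : box (L + N) (k, j - n%:Z + d%:Z) by rewrite /box /=; lia.
  have [_ /=] := dS _ jb; rewrite addrK lt_min => /andP[_]; apply: le_lt_trans.
  by rewrite ler_wpM2l ?exprn_ge0// lerDr normc_ge0.
Qed.

End small_boxes.

(** * Return times and small times *)

Lemma wspace_indicator (R : realType) (I : choiceType) (K : space_kind R)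
    (mu : weight R I) (A : set I) : finite_set A ->
  exists f : wspace K mu, forall v, f v = (v \in A)%:R.
Proof.
move=> /finite_seqP [s ->]; exists (\sum_(u <- undup s) wdelta u) => v.
rewrite wspace_fun_sum; have -> : (v \in [set` s]) = (v \in undup s).
  by rewrite mem_undup; apply/idP/idP; rewrite inE.
have [vs|vs] := boolP (v \in undup s).
  rewrite (bigD1_seq v) ?undup_uniq// big1 /= ?eqxx ?addr0// => u /negbTE.
  by rewrite eq_sym => ->.
rewrite big_seq big1// => u us /=; have [vu|//] := eqVneq v u.
by rewrite vu us in vs.
Qed.

(** * Small times give transitivity *)

Section transitivity.
Context {R : realType} {m : nat} {K : space_kind R} {mu : weight R (lattice m)}.
Context (B : {linear wspace K mu -> wspace K mu}).
Context (B_shift : forall f : wspace K mu,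
  wspace_fun (B f) = backward_shift (wspace_fun f)).

Lemma iter_linearP n (c : R[i]) f g :
  iter n B (c *: f + g) = c *: iter n B f + iter n B g.
Proof. by elim: n => //= n ->; rewrite linearP. Qed.

(** The two halves of a hypercyclicity criterion, restricted to small times. Being stable under
    linear combinations, it has to be checked on basis vectors only. *)
Definition shiftable (f : wspace K mu) : Prop := forall d : R, 0 < d ->
  exists L : nat, exists2 e : R, 0 < e & forall n, small_times mu (box L) e n ->
    wnorm (iter n B f) <= d /\
    exists2 h, iter n B h = f & wnorm h <= d.

Lemma shiftable0 : shiftable 0.
Proof.
move=> d d0; exists 0%N; exists 1 => // n _.
have iter0 : iter n B 0 = 0 by elim: n => //= n ->; rewrite linear0.
by rewrite iter0 wnorm0 ltW//; split => //; exists 0; rewrite ?iter0 ?wnorm0 ?ltW.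
Qed.

Lemma shiftableP (c : R[i]) f g :
  shiftable f -> shiftable g -> shiftable (c *: f + g).
Proof.
(* Adding [1] keeps [q] positive when [c = 0], and still [normc c * q <= d / 2]. *)
move=> sf sg d d0; pose q := d / 2 / (normc c + 1).
have c1 : 0 < normc c + 1 by rewrite ltr_wpDl ?normc_ge0.
have q0 : 0 < q by rewrite !divr_gt0.
have [Lf [ef ef0 fP]] := sf q q0.
have d20 : 0 < d / 2 by rewrite divr_gt0.
have [Lg [eg eg0 gP]] := sg (d / 2) d20.
exists (maxn Lf Lg); exists (Num.min ef eg); first by rewrite lt_min ef0.
move=> n nS.
have [|fn [hf Bhf hf_le]] := fP n.
  apply: small_timesS nS; last by rewrite ge_min lexx.
  by move=> v; rewrite /box /= leq_max => ->.
have [|gn [hg Bhg hg_le]] := gP n.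
  apply: small_timesS nS; last by rewrite ge_min lexx orbT.
  by move=> v; rewrite /box /= leq_max => ->; rewrite orbT.
have key u w : wnorm u <= q -> wnorm w <= d / 2 ->
    wnorm (c *: u + w : wspace K mu) <= d.
  move=> uq wd; apply: (le_trans (wnormD _ _)).
  rewrite wnormZ [leRHS]splitr lerD// (@le_trans _ _ ((normc c + 1) * q))//.
    by rewrite ler_pM ?normc_ge0 ?wnorm_ge0// lerDl.
  by rewrite mulrC divfK ?gt_eqF.
split; first by rewrite iter_linearP key.
by exists (c *: hf + hg); [rewrite iter_linearP Bhf Bhg|exact: key].
Qed.

Lemma shiftable_ebas s j : shiftable (ebas s j).
Proof.
have [m0|m0] := leqP m 0.
  by rewrite ebas_ge ?(leq_trans m0)//; exact: shiftable0.
(* The sums for [B^n] and for its right inverse have [m] terms, each of norm at most [e]. *)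
move=> d d0; pose e := d / m.+1%:R.
have e0 : 0 < e by rewrite divr_gt0.
have med : m%:R * e <= d.
  by rewrite mulrCA ger_pMr// ler_pdivrMr// mul1r ler_nat.
exists (`|j| + m)%N; exists e => // n nS.
have n0 : (0 < n)%N by have [] := nS (Ordinal m0, 0) isT.
split.
  rewrite (iterB_ebas B_shift); apply: le_trans med.
  apply: (small_box_sum (t := - n%:Z) (a := fun r => 'C(n, r)%:R)
            s (ltW e0) nS (leqnn _) _ n0).
    by rewrite abszN.
  by move=> r; rewrite normc_nat -natrX ler_nat bin_leX.
exists (ebas_inv n s j); first exact: iterB_ebas_inv.
apply: le_trans med.
apply: (small_box_sum (t := n%:Z) (a := neg_bin R[i] n)
          s (ltW e0) nS (leqnn _) _ n0) => //.
by move=> r; rewrite normc_neg_bin -natrX ler_nat neg_bin_leX.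
Qed.

(** Stated for any upward closed [F], as it is applied to a Furstenberg family and to its
    enlargement. *)
Lemma F_transitive_of_small_times (F : set (set nat)) :
  (forall A C : set nat, F A -> A `<=` C -> F C) ->
  (forall L (e : R), 0 < e -> F (small_times mu (box L) e)) ->
  F_transitive F B.
Proof.
move=> Fup Fsmall U V oU oV [f Uf] [g Vg].
have [df df0 Uball] := open_wnormP oU Uf.
have [dg dg0 Vball] := open_wnormP oV Vg.
have df3 : 0 < df / 3 by rewrite divr_gt0.
have dg3 : 0 < dg / 3 by rewrite divr_gt0.
have [sf sfP] := wdelta_dense f df3; have [sg sgP] := wdelta_dense g dg3.
have shift (u : wspace K mu) (s : seq (lattice m)) :
    shiftable (\sum_(v <- s) u v *: wdelta v).
  elim: s => [|[k j] s IH]; first by rewrite big_nil; exact: shiftable0.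
  by rewrite big_cons; apply: shiftableP => //; rewrite -ebas_rev; exact: shiftable_ebas.
(* The scales cross: the image of the approximant of [f] perturbs a point of [V], while the preimage
   of that of [g] perturbs a point of [U]. *)
have [Lf [ef ef0 fP]] := shift f sf _ dg3.
have [Lg [eg eg0 gP]] := shift g sg _ df3.
apply: (Fup (small_times mu (box (maxn Lf Lg)) (Num.min ef eg))).
  by apply: Fsmall; rewrite lt_min ef0.
move=> n nS; set f0 := \sum_(v <- sf) _ in sfP fP; set g0 := \sum_(v <- sg) _ in sgP gP.
have [|fn _] := fP n.
  apply: small_timesS nS; last by rewrite ge_min lexx.
  by move=> v; rewrite /box /= leq_max => ->.
have [|_ [h Bh hle]] := gP n.
  apply: small_timesS nS; last by rewrite ge_min lexx orbT.
  by move=> v; rewrite /box /= leq_max => ->; rewrite orbT.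
exists (g0 + iter n B f0); split.
  exists (f0 + h).
    apply: Uball; rewrite opprD addrA; apply: (le_lt_trans (wnormD _ _)).
    by rewrite wnormN; apply: (le_lt_trans (lerD sfP hle)); lra.
  by rewrite -[f0 in LHS]scale1r iter_linearP Bh scale1r addrC.
apply: Vball; rewrite opprD addrA; apply: (le_lt_trans (wnormD _ _)).
by rewrite wnormN; apply: (le_lt_trans (lerD sgP fn)); lra.
Qed.

End transitivity.

(** * Return times force small weights *)

Section necessity.
Context {R : realType} {m : nat} {K : space_kind R} {mu : weight R (lattice m)}.
Context (B : {linear wspace K mu -> wspace K mu}).
Context (B_shift : forall f : wspace K mu,
  wspace_fun (B f) = backward_shift (wspace_fun f)).

Definition wball (f : wspace K mu) (d : R) : set (wspace K mu) :=
  [set g | wnorm (f - g) < d].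

(** The vertical shift contributes nothing on the last row. *)
Lemma ext_iterB_last f n j :
  ext (iter n B f) m.-1 j = ext f m.-1 (j + n%:Z).
Proof.
elim: n j => [|n IH] j; first by rewrite addr0.
rewrite iterS (ext_B B_shift) IH [ext _ m.-1.+1 _]ext_ge ?leqSpred// addr0.
by congr ext; lia.
Qed.

Lemma return_small_times (L : nat) (e : R) : (0 < m)%N -> 0 < e ->
  exists (f0 : wspace K mu) (N : nat), exists2 d : R, 0 < d &
    (forall M n : nat, (0 < M)%N -> (N < n)%N ->
      return_set B (wball f0 d) (wball (M%:R *: f0) d) n ->
      small_times mu (box L) e n) /\
    (forall n : nat, (n <= N)%N ->
      ~ return_set B (wball f0 d) (wball (3%:R *: f0) d) n).
Proof.
(* With [W = L + m] the entries [(k + r, j - r)] used below stay over the columns of the segment;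
   [n > N] puts [j + n] and [j - n] outside it and gives [2 * q <= n] for [bin_geX]. *)
move=> m0 e0; pose W := (L + m)%N; pose N := (2 * W)%N.
pose A := [set v : lattice m | (v.1.+1 == m) && (`|v.2| <= W)%N].
have fA : finite_set A.
  by apply: sub_finite_set (finite_box W) => v /andP[].
have [f0 f0A] := wspace_indicator K mu fA.
have {}f0A v : f0 v = ((v.1.+1 == m) && (`|v.2| <= W)%N)%:R.
  by rewrite f0A; congr (nat_of_bool _)%:R; apply/idP/idP; rewrite inE.
have [eta eta0 etaP] := @box_lower _ _ mu (W + N).
(* [kap] inverts the constant of [bin_geX], and [d'] below is the error that [dominant_term]
   tolerates. *)
pose kap : R := (2 ^ m * m`!)%:R^-1.
have D0 : (0 < 2 ^ m * m`!)%N by rewrite muln_gt0 expn_gt0 fact_gt0.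
have kap0 : 0 < kap by rewrite invr_gt0 ltr0n.
have kap1 : kap <= 1 by rewrite invf_le1 ?ltr0n// ler1n.
pose d' : R := kap / (2 * m.+1%:R).
have d'0 : 0 < d' by rewrite divr_gt0// mulr_gt0.
have d'kap : d' * m.+1%:R * 2 <= kap.
  by rewrite /d' -mulrA [_ * 2]mulrC divfK// gt_eqF// mulr_gt0.
have d'2 : d' * 2 <= 1.
  apply: le_trans (le_trans d'kap kap1); rewrite ler_pM2r//.
  by rewrite ler_peMr ?(ltW d'0)// ler1n.
(* The first bound makes the errors on the box at most [d'] entrywise; the second leaves [e / 4] for
   each weight after division by [kap / 2]. *)
pose d := Num.min (d' * eta) (e * kap / 8).
have d0 : 0 < d by rewrite lt_min mulr_gt0//= divr_gt0// mulr_gt0.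
exists f0, N, d => //.
have near M u v : wball (M *: f0) d u -> box (W + N) v ->
    normc (M * f0 v - u v) <= d'.
  move=> ud vb; rewrite -(ler_pM2r eta0).
  apply: le_trans (ltW (lt_le_trans ud _)); last by rewrite ge_min lexx.
  apply: le_trans (modulus_le_wnorm _ v).
  by rewrite wspace_funB wspace_funZ normcM mulrC ler_wpM2r ?normc_ge0// etaP.
split; last first.
  (* The entry of [f] at column [n] of the last row has modulus at most [1 + d'], yet as the entry
     of [B^n f] at column [0] it is within [d'] of [3], against [2 * d' <= 1]. *)
  move=> n nN [_ [[f fd <-] gd]].
  have k0P : (m.-1 < m)%N by rewrite prednK.
  pose k0 := Ordinal k0P.
  have b0 : box (W + N) (k0, 0) by [].
  have bn : box (W + N) (k0, n%:Z) by rewrite /box /=; lia.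
  have := near _ _ _ gd b0; rewrite f0A /= prednK// eqxx mulr1.
  have := ext_iterB_last f n 0; rewrite add0r -[m.-1]/(val k0) !extE => ->.
  have fd1 : wball (1%:R *: f0) d f by rewrite scale1r.
  have := near _ _ _ fd1 bn; rewrite mul1r; set x := f _; set y := f0 _.
  have y1 : normc y <= 1 by rewrite /y f0A normc_nat lern1 leq_b1.
  have := normc_leB (3%:R : R[i]) x; rewrite normc_nat.
  have := normc_leB x y; rewrite normc_sub.
  by move: d'2 y1; clear; lra.
move=> M n M0 Nn [_ [[f fd <-] gd]] [k j]; rewrite {1}/box /= => jL.
split; first by lia.
set q := (m - k.+1)%N; have km := ltn_ord k.
(* Row [k + q] is the last one, where [u] is near [M']; in the rows before it [u] is nearly zero, so
   [dominant_term] isolates [r = q]. *)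
have big (u : wspace K mu) (M' : nat) (a : nat -> R[i]) : (0 < M')%N ->
    wball (M'%:R *: f0) d u ->
    (forall r, normc (a r) <= n%:R ^+ r) -> kap * n%:R ^+ q <= normc (a q) ->
    kap / 2 * n%:R ^+ q <=
      normc (\sum_(r < m) a r * ext u (k + r) (j - r%:Z)).
  move=> M'0 ud a_le a_ge.
  have bb r (rm : (k + r < m)%N) : box (W + N) (Ordinal rm, j - r%:Z).
    by rewrite /box /=; lia.
  apply: (dominant_term (d := d') (k := q)
    (y := fun r => ext u (k + r) (j - r%:Z))) => //.
  - by rewrite /q; lia.
  - by rewrite (ltW kap0).
  - exact: ltW.
  - move=> r rq; apply: le_trans (a_le r) _; rewrite ler_weXn2l// ?ler1n//; lia.
  - move=> r rq; have rm : (k + r < m)%N by move: rq; rewrite /q; lia.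
    have := near _ _ _ ud (bb r rm); rewrite f0A /= ltn_eqF /=.
      by rewrite mulr0 normc_sub subr0 -extE.
    by move: rq; rewrite /q; lia.
  - have qm : (k + q < m)%N by rewrite /q; lia.
    have := near _ _ _ ud (bb q qm); rewrite f0A /= (_ : _ && _); last first.
      by rewrite /q; lia.
    rewrite mulr1 -extE /=; set x := ext _ _ _.
    have := normc_leB (M'%:R : R[i]) x; rewrite normc_nat.
    have : 1 <= M'%:R :> R by rewrite ler1n.
    by clear; lra.
  - by move=> r rq; rewrite ext_ge//; move: rq; rewrite /q; lia.
(* Outside the segment [f0] vanishes, so the entry of [u] is pure error, of weighted modulus below
   [d <= e * kap / 8]. *)
have small (u : wspace K mu) (c : R[i]) (l : int) : (W < `|l|)%N ->
    wball (c *: f0) d u -> kap / 2 * n%:R ^+ q <= normc (u (k, l)) ->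
    n%:R ^+ q * normc (mu (k, l)) <= e / 4.
  move=> Wl ud ub; have c0 : 0 < kap / 2 by rewrite divr_gt0.
  rewrite -(ler_pM2l c0) mulrA.
  apply: (@le_trans _ _ (normc (u (k, l)) * normc (mu (k, l)))).
    by rewrite ler_wpM2r ?normc_ge0.
  rewrite mulrC -normcM; apply: (@le_trans _ _ (wnorm (c *: f0 - u))).
    apply: le_trans (modulus_le_wnorm _ (k, l)).
    rewrite wspace_funB wspace_funZ f0A /= (leqNgt _ W) Wl andbF mulr0.
    by rewrite sub0r mulrN -[- _]sub0r normc_sub subr0.
  apply: (le_trans (ltW ud)); rewrite /d ge_min; apply/orP; right.
  by rewrite le_eqVlt; apply/orP; left; apply/eqP; field.
have nat_kap (C : nat) : (n ^ q <= 2 ^ m * m`! * C)%N ->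
    kap * n%:R ^+ q <= C%:R.
  move=> H; rewrite mulrC ler_pdivrMr ?ltr0n// -natrX -natrM ler_nat.
  by rewrite mulnC.
have fd1 : wball (1%:R *: f0) d f by rewrite scale1r.
rewrite mulrDr; apply: (@le_lt_trans _ _ (e / 4 + e / 4)); last by lra.
apply: lerD.
  (* The entry of [f] at [j + n] is expressed through [B^n f], which is near [M f0]. *)
  apply: (small f 1%:R) => //; first by lia.
  rewrite -extE (ext_iterB_inv B_shift).
  apply: (big _ M) => // [r|].
    by rewrite normc_neg_bin -natrX ler_nat neg_bin_leX//; lia.
  by rewrite normc_neg_bin; apply/nat_kap/neg_bin_geX; rewrite /q; lia.
(* Dually, the entry of [B^n f] at [j - n] is expressed through [f], which is near [f0]. *)
apply: (small (iter n B f) M%:R) => //; first by lia.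
rewrite -extE (ext_iterB B_shift).
under eq_bigr do rewrite subrK.
apply: (big f 1%N (fun r => 'C(n, r)%:R)) => // [r|].
  by rewrite normc_nat -natrX ler_nat bin_leX.
by rewrite normc_nat; apply/nat_kap/bin_geX; rewrite /q; lia.
Qed.

Lemma small_times_of_F_transitive (F : set (set nat)) L (e : R) : (0 < m)%N ->
  (forall A C : set nat, F A -> A `<=` C -> F C) ->
  F_transitive F B -> 0 < e -> F (small_times mu (box L) e).
Proof.
move=> m0 Fup FB e0; have [f0 [N [d d0 [H1 H2]]]] := return_small_times L m0 e0.
have ne f : wball f d !=set0 by exists f; rewrite /wball /= subrr wnorm0.
apply: (Fup _ _ (FB _ _ (@wball_open _ _ _ _ f0 d) (@wball_open _ _ _ _ (3%:R *: f0) d)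
                   (ne _) (ne _))) => n nr.
 apply: (H1 3%N) => //.
by rewrite ltnNge; apply/negP => nN; exact: H2 nN nr.
Qed.

(** For [M = 1] the two balls coincide and return times such as [0] say nothing; the tail condition
    on [F] cuts off those up to [N]. *)
Lemma small_times_of_recurrent (F : set (set nat)) L (e : R) : (0 < m)%N ->
  (forall A C : set nat, F A -> A `<=` C -> F C) ->
  (forall (A : set nat) (N : nat), (0 < N)%N -> F A ->
     F (A `&` [set n : nat | (N <= n)%N])) ->
  topologically_F_recurrent F B -> 0 < e -> F (small_times mu (box L) e).
Proof.
move=> m0 Fup Ftail FB e0; have [f0 [N [d d0 [H1 _]]]] := return_small_times L m0 e0.
have ne : wball f0 d !=set0 by exists f0; rewrite /wball /= subrr wnorm0.
apply: (Fup _ _ (Ftail _ N.+1 (ltn0Sn N) (FB _ (@wball_open _ _ _ _ f0 d) ne))).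
by move=> n [nr /= Nn]; apply: (H1 1%N) => //; rewrite scale1r.
Qed.

End necessity.

(** * The enlarged family and the equivalences *)

Lemma enlarged_up (F : set (set nat)) (A C : set nat) :
  enlarged F A -> A `<=` C -> enlarged F C.
Proof. by move=> FA AC N; have [D FD DA] := FA N; exists D => // n /DA /AC. Qed.

Lemma enlarged_sub (F : set (set nat)) (A : set nat) :
  (forall A C : set nat, F A -> A `<=` C -> F C) -> enlarged F A -> F A.
Proof.
move=> Fup /(_ 0%N) [D FD DA]; apply: (Fup _ _ FD) => n Dn; apply: DA.
by exists n => //; exists 0; rewrite ?lexx ?addr0.
Qed.

Theorem theorem3p2 (R : realType) (m : nat) (hm : (0 < m)%N)
    (mu : weight R (lattice m)) (K : space_kind R)
    (B : {linear wspace K mu -> wspace K mu})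
    (B_shift : forall f : wspace K mu,
      wspace_fun (B f) = backward_shift (wspace_fun f))
    (B_bounded : bounded_operator B)
    (F : set (set nat)) (hF : Furstenberg_family F) :
  [/\ F_transitive (enlarged F) B <-> F_transitive F B,
      F_transitive F B <->
        (forall (E : set (lattice m)) (eps : R),
           finite_set E -> E !=set0 -> 0 < eps -> F (small_times mu E eps))
    & (forall (A : set nat) (N : nat), (0 < N)%N -> F A ->
         F (A `&` [set n : nat | (N <= n)%N])) ->
      (F_transitive F B <-> topologically_F_recurrent F B)].
Proof.
case: hF => _ _ Fup.
have box_ne L : box (m := m) L !=set0 by exists (Ordinal hm, 0).
split.
- split=> FB U V oU oV nU nV; first exact: enlarged_sub Fup (FB U V oU oV nU nV).
  apply: (F_transitive_of_small_times B_shift (F := enlarged F)) => //.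
    exact: enlarged_up.
  (* The member of [F] for width [N] consists of the small times over the box widened by [N], at a
     smaller threshold. *)
  move=> L e e0 N; have [e' e'0 shiftP] := @small_times_shift _ _ mu L N e hm e0.
  exists (small_times mu (box (L + N)) e').
    exact: (small_times_of_F_transitive B_shift).
  move=> n [d dS [k /andP[kN Nk] nE]]; apply: shiftP dS _ _; lia.
- split=> [FB E e fE _ e0|FE].
    have [L EL] := finite_sub_box fE.
    apply: (Fup _ _ (small_times_of_F_transitive B_shift L hm Fup FB e0)).
    exact: small_timesS.
  apply: (F_transitive_of_small_times B_shift) => // L e e0.
  by apply: FE => //; exact: finite_box.
- move=> Ftail; split=> [FB U oU nU|FB]; first exact: FB.
  (* Recurrence yields transitivity through the small times. *)
  apply: (F_transitive_of_small_times B_shift) => // L e e0.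
  exact: (small_times_of_recurrent B_shift).
Qed.
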